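(* There is an absolute constant $c>0$ such that the following holds. Let $p>3$ be a prime that splits completely in $K=\mathbb{Q}(\omega,3^{1/6})$, where $\omega=e^{\pi i/6}$, and let $a_1,a_2,a_3\in\{1,\dots,p\}$ be integers with \[P_1(a_1,a_2,a_3)\equiv-1,\quad P_2(a_1,a_2,a_3)\equiv3,\quad P_3(a_1,a_2,a_3)\equiv-1,\quad P_4(a_1,a_2,a_3)\equiv-1\pmod p.\] Then for all sufficiently large $L$ (in terms of $p$) there exists $\Lambda\subseteq\{0,\dots,L-1\}$ with at least $L^{1-c/\sqrt{\log p}}$ elements containing no solutions $(w,x,y,z)\in\Lambda^4$, other than those with $w=x=y=z$, to \[P_1(a_1,a_2,a_3)w+P_2(a_1,a_2,a_3)x+P_3(a_1,a_2,a_3)y+P_4(a_1,a_2,a_3)z=0.\]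
   Context: $P_1(X,Y,Z)=(X-Y)(Y-Z)(Z-X)$, $P_2(X,Y,Z)=YZ(Y-Z)$, $P_3(X,Y,Z)=ZX(Z-X)$, $P_4(X,Y,Z)=XY(X-Y)$. *)

(* Defs.v *)
From HB Require Import structures.
From mathcomp Require Import all_boot all_order all_algebra all_field.
From mathcomp Require Import ring_quotient.
From mathcomp Require Import all_classical all_reals all_analysis.

Set Implicit Arguments.
Unset Strict Implicit.
Unset Printing Implicit Defensive.

Import Order.TTheory GRing.Theory Num.Theory.
Local Open Scope ring_scope.
Local Open Scope classical_set_scope.

Section RingOfIntegers.
Variable K : fieldExtType rat.

Definition integral_pred : {pred K} :=
  fun x => `[< integralOver (intr : int -> K) x >].

Fact integral_pred_subring : subring_closed integral_pred.
Proof.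
split=> [|x y|x y]; rewrite /in_mem /=.
- exact/asboolP/integral1.
- by move=> /asboolP intx /asboolP inty; apply/asboolP/integral_sub.
- by move=> /asboolP intx /asboolP inty; apply/asboolP/integral_mul.
Qed.

HB.instance Definition _ :=
  GRing.isSubringClosed.Build K integral_pred integral_pred_subring.

Record ring_of_integers : predArgType :=
  RingOfIntegers { int_val :> K ; _ : int_val \in integral_pred }.

HB.instance Definition _ := [isSub of ring_of_integers for int_val].
HB.instance Definition _ := [Choice of ring_of_integers by <:].
HB.instance Definition _ :=
  [SubChoice_isSubComNzRing of ring_of_integers by <:].

End RingOfIntegers.

Section Ideals.
Variable A : comNzRingType.

(* [idealr_closed] is the library's predicate for proper ideals. *)
Definition prime_ideal (I : set A) : Prop :=
  idealr_closed [in I] /\ prime_idealr_closed [in I].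

Definition ideal_mul (I J : set A) : set A :=
  [set x | exists2 s : seq (A * A),
     forall u, u \in s -> I u.1 /\ J u.2 & x = \sum_(u <- s) u.1 * u.2].

Definition principal_ideal (a : A) : set A := [set a * x | x in [set: A]].

End Ideals.

(* pO_K is a product of [K : Q] pairwise distinct prime ideals of O_K. *)
Definition splits_completely (p : nat) (K : fieldExtType rat) : Prop :=
  exists P : 'I_(\dim {:K}) -> set (ring_of_integers K),
    [/\ injective P, forall i, prime_ideal (P i)
      & principal_ideal p%:R = \big[@ideal_mul _/setT]_i P i].

(* e^(pi i / 6) = cos (pi / 6) + i sin (pi / 6) *)
Definition omega : algC := (sqrtC 3 + 'i) / 2.

(* [num_field_exists [:: x; y]] supplies a finite extension of Q with an
   embedding into algC, generated over Q by preimages of x and y. On a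
   nonnegative argument [6.-root] is the nonnegative real sixth root. *)
Definition Q_omega_root3 : fieldExtType rat :=
  tag (num_field_exists [:: omega; 6.-root 3]).

Definition P1 (X Y Z : int) : int := (X - Y) * (Y - Z) * (Z - X).
Definition P2 (X Y Z : int) : int := Y * Z * (Y - Z).
Definition P3 (X Y Z : int) : int := Z * X * (Z - X).
Definition P4 (X Y Z : int) : int := X * Y * (X - Y).

(* Main.v *)
Require Import Defs.
From mathcomp Require Import all_boot all_order all_algebra all_field.
From mathcomp Require Import all_classical all_reals all_analysis.
From mathcomp Require Import zify ring lra.

Set Implicit Arguments.
Unset Strict Implicit.
Unset Printing Implicit Defensive.

Import Order.TTheory GRing.Theory Num.Theory.
Local Open Scope ring_scope.

(** The four coefficients sum to [0] identically, and modulo [p] the equation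
    reads [3 x = w + y + z].  Behrend's construction (vectors on a sphere, read
    as digits in base [3 m] so that no carry occurs) gives a set [D] of
    residues without nontrivial solutions to this congruence and with
    [#|D| >= exp (s^2 - 7 s)], where [s = sqrt (ln p)].  Take for [Lambda] the
    integers whose [k] digits in base [p] lie in [D], where
    [p ^ k <= L < p ^ k.+1]: the lowest digits of a solution coincide, and since
    the coefficients sum to [0] they can be subtracted and the rest divided
    by [p]. *)

(** * Base-[B] expansions *)

(** The lowest digit has index [0]. Digits are arbitrary naturals, so a digitwise sum keeps this
    form and carries are excluded afterwards by a bound. *)
Definition radix (B n : nat) (u : 'I_n -> nat) : nat :=
  (\sum_(i < n) u i * B ^ i)%N.

Lemma radix_recl B n (u : 'I_n.+1 -> nat) :
  radix B u = (u ord0 + B * radix B (fun i => u (lift ord0 i)))%N.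
Proof.
rewrite /radix big_ord_recl expn0 muln1 big_distrr /=; congr addn.
by apply: eq_bigr => i _; rewrite /bump /= add1n expnS mulnCA.
Qed.

Lemma radix_lt B n (u : 'I_n -> nat) :
  (forall i, u i < B)%N -> (radix B u < B ^ n)%N.
Proof.
elim: n u => [|n IHn] u ltuB; first by rewrite /radix big_ord0.
rewrite radix_recl expnS.
have lt := IHn _ (fun i => ltuB (lift ord0 i)).
apply: (@leq_trans (B * (radix B (fun i => u (lift ord0 i))).+1)).
  by rewrite mulnS ltn_add2r.
by rewrite leq_mul2l lt orbT.
Qed.

Lemma radix_inj B n (u v : 'I_n -> nat) :
  (forall i, u i < B)%N -> (forall i, v i < B)%N ->
  radix B u = radix B v -> forall i, u i = v i.
Proof.
elim: n u v => [|n IHn] u v ltuB ltvB; first by move=> _ [].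
rewrite !radix_recl => e.
have e0 : u ord0 = v ord0.
  have := congr1 (modn^~ B) e.
  rewrite ![(B * _)%N]mulnC ![(u ord0 + _)%N]addnC ![(v ord0 + _)%N]addnC.
  by rewrite !modnMDl !modn_small.
move=> i; case: (unliftP ord0 i) => [j|] -> //.
apply: (IHn (fun i => u (lift ord0 i)) (fun i => v (lift ord0 i))) => //.
move/eqP: e; rewrite e0 eqn_add2l eqn_pmul2l => [/eqP //|].
exact: leq_ltn_trans (ltuB ord0).
Qed.

Lemma radix_add B n (u v : 'I_n -> nat) :
  (radix B u + radix B v)%N = radix B (fun i => u i + v i)%N.
Proof.
by rewrite /radix -big_split; apply: eq_bigr => i _; rewrite mulnDl.
Qed.

(** * Spheres and the pigeonhole principle *)

(** With [3 x = w + y + z], the squared distances from [x] to [w], [y], [z] add up to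
    [|w|^2 + |y|^2 + |z|^2 - 3 |x|^2], which vanishes on a sphere. *)
Lemma sphere_centroid (I : finType) (w x y z : I -> nat) (r : nat) :
  (\sum_i w i ^ 2 = r)%N -> (\sum_i x i ^ 2 = r)%N ->
  (\sum_i y i ^ 2 = r)%N -> (\sum_i z i ^ 2 = r)%N ->
  (forall i, 3 * x i = w i + y i + z i)%N ->
  forall i, [/\ w i = x i, x i = y i & y i = z i].
Proof.
move=> Ew Ex Ey Ez e.
have sqE (u : I -> nat) : (\sum_i u i ^ 2)%N = r -> \sum_i (u i)%:Z ^+ 2 = r%:Z.
  move=> <-; rewrite (big_morph Posz PoszD (erefl _)).
  by apply: eq_bigr => i _; rewrite -mulnn PoszM expr2.
pose d i : int := ((w i)%:Z - (x i)%:Z) ^+ 2 + ((y i)%:Z - (x i)%:Z) ^+ 2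
  + ((z i)%:Z - (x i)%:Z) ^+ 2.
have d_ge0 i : 0 <= d i by rewrite !addr_ge0 ?sqr_ge0.
have dE i : d i = (w i)%:Z ^+ 2 + (y i)%:Z ^+ 2 + (z i)%:Z ^+ 2 - 3 * (x i)%:Z ^+ 2.
  rewrite /d; have := e i; nia.
have sumd : \sum_i d i = 0.
  rewrite (eq_bigr _ (fun i _ => dE i)) sumrB !big_split /= -mulr_sumr !sqE //; ring.
move=> i; have : d i = 0 by exact: psumr_eq0P (fun i _ => d_ge0 i) sumd _ isT.
rewrite /d; split; nia.
Qed.

Lemma large_fibre (T : finType) (N : nat) (f : T -> nat) :
  (forall t, f t < N)%N -> (0 < N)%N ->
  exists r : nat, (#|T| <= #|[set t | f t == r]| * N)%N.
Proof.
move=> ltfN N0; apply: contrapT => noR.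
have lt (r : nat) : (#|[set t | f t == r]| * N < #|T|)%N.
  by rewrite ltnNge; apply/negP => ?; apply: noR; exists r.
have cardT : #|T| = (\sum_(r < N) #|[set t | f t == r]|)%N.
  rewrite -sum1_card (partition_big (fun t => Ordinal (ltfN t)) xpredT) //=.
  apply: eq_bigr => r _; rewrite -sum1_card; apply: eq_bigl => t.
  by rewrite inE.
(* If every fibre were too small, the left side, equal to [#|T| * N], would be at most
   [N * (#|T| - 1)]. *)
have : (\sum_(r < N) (#|[set t | f t == r]| * N) <= \sum_(r < N) #|T|.-1)%N.
  by apply: leq_sum => r _; have := lt r; lia.
rewrite -big_distrl /= -cardT sum_nat_const card_ord mulnC leq_pmul2l //.
by rewrite leqNgt ltn_predL (leq_ltn_trans (leq0n _) (lt 0%N)).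
Qed.

(** * Behrend's construction modulo [p] *)

Definition centroid_free {p : nat} (D : {set 'I_p}) : Prop :=
  forall w x y z : 'I_p, w \in D -> x \in D -> y \in D -> z \in D ->
  (p %| 3 * (x : nat)%:Z - ((w : nat)%:Z + (y : nat)%:Z + (z : nat)%:Z))%Z ->
  [/\ w = x, x = y & y = z].

(** Squared norms on the cube of side [m] take fewer than [n * m ^ 2 + 1] values, so some sphere
    holds enough of its [m ^ n] points; these are encoded in base [3 * m]. *)
Lemma behrend (p m n : nat) :
  (0 < m)%N -> (0 < n)%N -> ((3 * m) ^ n <= p)%N ->
  exists2 D : {set 'I_p}, centroid_free D & (m ^ n <= #|D| * (n * m ^ 2))%N.
Proof.
move=> m0 n0 lep.
pose V := {ffun 'I_n -> 'I_m}.
pose norm (v : V) := (\sum_i v i ^ 2)%N.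
have norm_lt v : (norm v < n * m ^ 2)%N.
  apply: (@leq_ltn_trans (\sum_(i < n) (m ^ 2).-1)).
    by apply: leq_sum => i _; rewrite -ltnS prednK ?expn_gt0 ?m0 // ltn_exp2r.
  by rewrite sum_nat_const card_ord ltn_pmul2l // prednK // expn_gt0 m0.
have [|r ler] := @large_fibre V _ norm norm_lt.
  by rewrite muln_gt0 n0 expn_gt0 m0.
pose code (v : V) := radix (3 * m) (fun i => v i).
have lt3 (v : V) i : (v i < 3 * m)%N by have := ltn_ord (v i); lia.
have code_lt v : (code v < p)%N.
  by apply: leq_trans lep; apply: radix_lt => i; apply: lt3.
pose enc v : 'I_p := Ordinal (code_lt v).
have enc_inj : injective enc.
  move=> u v [/radix_inj e]; apply/ffunP => i; apply: val_inj; exact: e.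
exists (enc @: [set v | norm v == r]); last first.
  by rewrite card_imset // -{1}(card_ord m) -{1}(card_ord n) -card_ffun.
move=> _ _ _ _ /imsetP[w Nw ->] /imsetP[x Nx ->] /imsetP[y Ny ->] /imsetP[z Nz ->].
move=> /= dvd.
have sum3_lt (i j k : 'I_m) : (i + j + k < 3 * m)%N.
  by have := ltn_ord i; have := ltn_ord j; have := ltn_ord k; lia.
have e : (code x + code x + code x = code w + code y + code z)%N.
  have lt1 : (code x + code x + code x < p)%N.
    apply: leq_trans lep; rewrite !radix_add; apply: radix_lt => i; exact: sum3_lt.
  have lt2 : (code w + code y + code z < p)%N.
    apply: leq_trans lep; rewrite !radix_add; apply: radix_lt => i; exact: sum3_lt.
  have [t et] := dvdzP dvd.
  (* Both sides lie in [[0, p)], so a difference divisible by [p] is zero. *)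
  have t0 : t = 0 by nia.
  by move: et; rewrite t0; lia.
move: Nw Nx Ny Nz; rewrite !inE => /eqP Nw /eqP Nx /eqP Ny /eqP Nz.
have eqs i : [/\ (w i : nat) = x i, (x i : nat) = y i & (y i : nat) = z i].
  apply: (sphere_centroid Nw Nx Ny Nz) => {}i.
  move: e; rewrite !radix_add => e.
  have <- := radix_inj (fun i => sum3_lt _ _ _) (fun i => sum3_lt _ _ _) e i.
  by rewrite mulSn mulSn mul1n addnA.
split; congr enc; apply/ffunP => i; apply: val_inj; by case: (eqs i).
Qed.

(** * From residues to integers, digit by digit *)

Lemma digitwise_free (p k : nat) (D : {set 'I_p}) (c1 c2 c3 c4 : int) :
  centroid_free D -> c1 + c2 + c3 + c4 = 0 ->
  (c1 = -1 %[mod p%:Z])%Z -> (c2 = 3 %[mod p%:Z])%Z ->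
  (c3 = -1 %[mod p%:Z])%Z -> (c4 = -1 %[mod p%:Z])%Z ->
  forall w x y z : 'I_k -> 'I_p,
  (forall i, w i \in D) -> (forall i, x i \in D) ->
  (forall i, y i \in D) -> (forall i, z i \in D) ->
  c1 * (radix p (fun i => w i))%:Z + c2 * (radix p (fun i => x i))%:Z
    + c3 * (radix p (fun i => y i))%:Z + c4 * (radix p (fun i => z i))%:Z = 0 ->
  forall i, [/\ w i = x i, x i = y i & y i = z i].
Proof.
move=> freeD sum0 e1 e2 e3 e4.
have dvdp c d : (c = d %[mod p%:Z])%Z -> exists t, c = d + t * p%:Z.
  by move=> /eqP; rewrite eqz_mod_dvd => /dvdzP[t et]; exists t; rewrite -et; ring.
have [t1 E1] := dvdp _ _ e1; have [t2 E2] := dvdp _ _ e2.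
have [t3 E3] := dvdp _ _ e3; have [t4 E4] := dvdp _ _ e4.
elim: k => [|k IHk] w x y z Dw Dx Dy Dz; first by move=> _ [].
rewrite !radix_recl !PoszD !PoszM.
set w' := radix _ _; set x' := radix _ _; set y' := radix _ _; set z' := radix _ _.
move=> e.
have [ewx exy eyz] : [/\ w ord0 = x ord0, x ord0 = y ord0 & y ord0 = z ord0].
  apply: freeD => //; apply/dvdzP.
  (* Substituting [c1 = -1 + t1 * p] and its analogues in the lowest-digit terms of the equation
     leaves [3 x0 - (w0 + y0 + z0)] plus [p] times the negative of this witness. *)
  exists (- (t1 * (w ord0 : nat)%:Z + t2 * (x ord0 : nat)%:Z + t3 * (y ord0 : nat)%:Z
     + t4 * (z ord0 : nat)%:Z + c1 * w'%:Z + c2 * x'%:Z + c3 * y'%:Z + c4 * z'%:Z)).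
  apply/eqP; rewrite -subr_eq0 -e E1 E2 E3 E4; apply/eqP; ring.
have p0 : p%:Z != 0.
  by rewrite eqz_nat -lt0n (leq_ltn_trans _ (ltn_ord (w ord0))).
have IH := IHk _ _ _ _ (fun i => Dw (lift ord0 i)) (fun i => Dx (lift ord0 i))
  (fun i => Dy (lift ord0 i)) (fun i => Dz (lift ord0 i)).
move=> i; case: (unliftP ord0 i) => [j|] -> //.
apply: IH; rewrite -/w' -/x' -/y' -/z'.
(* The common lowest digit enters with total coefficient [c1 + c2 + c3 + c4 = 0], so the equation is
   [p] times the one for the higher digits. *)
apply: (mulfI p0); rewrite mulr0 -e ewx exy eyz.
have -> : c1 = - (c2 + c3 + c4).
  by apply/eqP; rewrite -addr_eq0 !addrA sum0.
ring.
Qed.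

(** * Choice of the parameters *)

Lemma large_centroid_free (R : realType) (p : nat) :
  let s : R := Num.sqrt (ln p%:R) in 8 < s ->
  exists2 D : {set 'I_p}, centroid_free D & expR (s ^+ 2 - 7 * s) <= #|D|%:R.
Proof.
move=> s s8.
have lnp0 : 0 < ln p%:R :> R by rewrite -sqrtr_gt0 -/s; lra.
have s2 : s ^+ 2 = ln p%:R by rewrite sqr_sqrtr // ltW.
(* [ln] takes the default value [0] at nonpositive arguments. *)
have p0 : 0 < p%:R :> R.
  by rewrite ltNge; apply/negP => /ln0 e; rewrite e ltxx in lnp0.
have ps : p%:R = expR (s ^+ 2) :> R by rewrite s2 lnK.
(* Dimension about [s] and side about [exp (s - 2)]: since [3 <= exp 2], the base [3 * m] is at most
   [exp s], and its [n]-th power at most [exp (s ^ 2) = p]. *)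
pose n := Num.truncn s; pose m := Num.truncn (expR (s - 2)).
have s0 : 0 <= s by lra.
have /andP[len] := truncn_itv s0; rewrite -natr1 -/n in len * => ltn.
have /andP[lem] := truncn_itv (expR_ge0 (s - 2)).
rewrite -natr1 -/m in lem * => ltm.
have e2 : 3 <= expR 2 :> R by have := expR_ge1Dx (2 : R); lra.
have e1 : 2 <= expR 1 :> R by have := expR_ge1Dx (1 : R); lra.
(* Rounding down loses less than [1], and [1 <= exp (s - 3) <= exp (s - 2) - exp (s - 3)]. *)
have lowm : expR (s - 3) <= m%:R.
  have := expR_ge1Dx (s - 3).
  have : expR (s - 2) = expR (s - 3) * expR 1 by rewrite -expRD; congr expR; ring.
  nra.
have m0 : (0 < m)%N by rewrite -(ltr_nat R); apply: lt_le_trans lowm; exact: expR_gt0.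
have n0 : (0 < n)%N by rewrite -(ltr_nat R); lra.
have [|D freeD leD] := @behrend p m n m0 n0.
  rewrite -(ler_nat R) natrX natrM ps.
  apply: (@le_trans _ _ (expR s ^+ n)).
    apply: lerXn2r; rewrite ?nnegrE ?expR_ge0 ?mulr_ge0 //.
    have -> : s = 2 + (s - 2) by ring.
    by rewrite expRD; apply: ler_pM.
  rewrite -expRM_natl ler_expR; nra.
exists D => //.
have mn : expR ((s - 3) * (s - 1)) <= m%:R ^+ n.
  apply: (@le_trans _ _ (expR (s - 3) ^+ n)).
    by rewrite -expRM_natl ler_expR; nra.
  by apply: lerXn2r; rewrite ?nnegrE ?expR_ge0.
have nm : n%:R * m%:R ^+ 2 <= expR (3 * s - 4).
  have -> : 3 * s - 4 = s + 2%:R * (s - 2) by ring.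
  have ns : n%:R <= expR s.
    by apply: le_trans len (le_trans _ (expR_ge1Dx s)); rewrite lerDr.
  have m2 : m%:R ^+ 2 <= expR (s - 2) ^+ 2.
    by apply: lerXn2r; rewrite ?nnegrE ?expR_ge0.
  by rewrite expRD expRM_natl; apply: ler_pM; rewrite ?exprn_ge0.
move: leD; rewrite -(ler_nat R) natrX 2!natrM natrX => leD.
have : expR ((s - 3) * (s - 1)) <= #|D|%:R * expR (3 * s - 4).
  by apply: le_trans mn (le_trans leD _); apply: ler_wpM2l.
rewrite -ler_pdivrMr ?expR_gt0 // -expRN -expRD; apply: le_trans.
rewrite ler_expR.
have -> : (s - 3) * (s - 1) - (3 * s - 4) = s ^+ 2 - 7 * s + 7 by ring.
by rewrite lerDl.
Qed.

(** * The set [Lambda] and its size *)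

Theorem lemma5p3 (R : realType) :
  exists c : R, 0 < c /\
    forall p : nat, prime p -> (3 < p)%N -> splits_completely p Q_omega_root3 ->
    exists L0 : nat, forall a1 a2 a3 : int,
      1 <= a1 <= p%:Z -> 1 <= a2 <= p%:Z -> 1 <= a3 <= p%:Z ->
      (P1 a1 a2 a3 = -1 %[mod p%:Z])%Z ->
      (P2 a1 a2 a3 = 3 %[mod p%:Z])%Z ->
      (P3 a1 a2 a3 = -1 %[mod p%:Z])%Z ->
      (P4 a1 a2 a3 = -1 %[mod p%:Z])%Z ->
      forall L : nat, (L0 <= L)%N ->
      exists Lambda : {set 'I_L},
        L%:R `^ (1 - c / Num.sqrt (ln p%:R)) <= #|Lambda|%:R :> R /\
        forall w x y z : 'I_L,
          w \in Lambda -> x \in Lambda -> y \in Lambda -> z \in Lambda ->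
          P1 a1 a2 a3 * (w : nat)%:Z + P2 a1 a2 a3 * (x : nat)%:Z
            + P3 a1 a2 a3 * (y : nat)%:Z + P4 a1 a2 a3 * (z : nat)%:Z = 0 ->
          [/\ w = x, x = y & y = z].
Proof.
(* One more than the [7] of [large_centroid_free]: the spare [s * k] in the exponent pays for
   rounding [L] down to a power of [p]. *)
exists 8; split=> [|p _ p3 _]; first lra.
(* This threshold gives [k >= p >= s] below. *)
exists (p ^ p)%N => a1 a2 a3 _ _ _ e1 e2 e3 e4 L leL.
have L0 : (0 < L)%N by apply: leq_trans leL; rewrite expn_gt0; lia.
have L1 : 1 <= L%:R :> R by rewrite ler1n.
set s : R := Num.sqrt _.
have s0 : 0 < s by rewrite sqrtr_gt0 ln_gt0 // ltr1n; lia.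
(* For [s <= 8] the exponent [1 - 8 / s] is nonpositive, so a singleton is large enough. *)
case: (leP s 8) => [s8|s8].
  exists [set Ordinal L0]; split.
    rewrite cards1 -[leRHS](powRr0 L%:R) ler_powR // subr_le0 ler_pdivlMr //; lra.
  by move=> w x y z; rewrite !inE => /eqP-> /eqP-> /eqP-> /eqP->.
have [D freeD leD] := @large_centroid_free R p s8; rewrite -/s in leD.
have s2 : s ^+ 2 = ln p%:R by rewrite sqr_sqrtr // ln_ge0 // ler1n; lia.
have ps : p%:R = expR (s ^+ 2) :> R by rewrite s2 lnK // posrE ltr0n; lia.
pose k := trunc_log p L.
have /andP[lek ltk] : (p ^ k <= L < p ^ k.+1)%N by apply: trunc_log_bounds => //; lia.
have pk : (p <= k)%N by apply: trunc_log_max => //; lia.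
have enc_lt (v : {ffun 'I_k -> 'I_p}) : (radix p (fun i => v i) < L)%N.
  by apply: leq_trans lek; apply: radix_lt.
pose enc v : 'I_L := Ordinal (enc_lt v).
have enc_inj : injective enc.
  by move=> u v [/radix_inj e]; apply/ffunP => i; apply: val_inj; exact: e.
exists (enc @: [set v | v \in ffun_on D]); split; last first.
  move=> _ _ _ _ /imsetP[w + ->] /imsetP[x + ->] /imsetP[y + ->] /imsetP[z + ->].
  rewrite !inE => /ffun_onP Dw /ffun_onP Dx /ffun_onP Dy /ffun_onP Dz /= e.
  have sum0 : P1 a1 a2 a3 + P2 a1 a2 a3 + P3 a1 a2 a3 + P4 a1 a2 a3 = 0.
    by rewrite /P1 /P2 /P3 /P4; ring.
  have eqs := @digitwise_free p k D _ _ _ _ freeD sum0 e1 e2 e3 e4 _ _ _ _ Dw Dx Dy Dz e.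
  by split; congr enc; apply/ffunP => i; case: (eqs i).
rewrite card_imset // cardsE card_ffun_on card_ord natrX.
apply: (@le_trans _ _ (expR (s ^+ 2 - 7 * s) ^+ k)); last first.
  by apply: lerXn2r; rewrite ?nnegrE ?expR_ge0.
have sk : s <= k%:R.
  apply: (@le_trans _ _ p%:R); last by rewrite ler_nat.
  rewrite ps; apply: le_trans (expR_ge1Dx _).
  by have := sqr_ge0 (s - 1); clear -s8; nra.
(* This is the logarithm of [L < p ^ k.+1]. *)
have lnL : ln L%:R <= s ^+ 2 * (k%:R + 1).
  rewrite -[leRHS]expRK ler_ln ?posrE ?expR_gt0 ?ltr0n //.
  by rewrite natr1 mulrC expRM_natl -ps -natrX ler_nat ltnW.
rewrite /powR gt_eqF ?ltr0n // -expRM_natl ler_expR.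
apply: (@le_trans _ _ ((1 - 8 / s) * (s ^+ 2 * (k%:R + 1)))).
  apply: ler_wpM2l => //; rewrite subr_ge0 ler_pdivrMr //; lra.
have -> : (1 - 8 / s) * (s ^+ 2 * (k%:R + 1)) = (s ^+ 2 - 8 * s) * (k%:R + 1).
  by field; rewrite gt_eqF.
rewrite -subr_ge0.
(* The gap between the two exponents is nonnegative because [s <= k]. *)
have -> : k%:R * (s ^+ 2 - 7 * s) - (s ^+ 2 - 8 * s) * (k%:R + 1)
    = s * (k%:R - s) + 8 * s by ring.
by rewrite addr_ge0 ?mulr_ge0 ?subr_ge0 // ltW.
Qed.
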